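(* Let $f:(0,\infty)\to(0,\infty)$ be operator monotone, extended by $f(0)=0$. Let $\phi:\mathbb{M}_n\to\mathbb{M}_m$ be a linear map satisfying the Schwarz inequality $\phi(K^*K)\geq\phi(K)^*\phi(K)$ for all $K\in\mathbb{M}_n$ (no unitality assumed), with Hilbert–Schmidt adjoint $\phi^*$. Then for all positive definite $X,Y\in\mathbb{M}_m$: (a) $\phi\,\mathbb{J}_f(\phi^*(X),\phi^*(Y))^{+}\,\phi^*\leq\mathbb{J}_f(X,Y)^{-1}$ as operators on $\mathcal{H}_m$; (b) $\phi^*\,\mathbb{J}_f(X,Y)\,\phi\leq\mathbb{J}_f(\phi^*(X),\phi^*(Y))$ as operators on $\mathcal{H}_n$.
   Context: $\mathcal{H}_k$ denotes $\mathbb{M}_k$ (complex $k\times k$ matrices) with the Hilbert–Schmidt inner product $\langle A,B\rangle=\mathrm{Tr}[A^*B]$; $\phi:\mathcal{H}_n\to\mathcal{H}_m$ and $\phi^*:\mathcal{H}_m\to\mathcal{H}_n$ is its adjoint. For $X\in\mathbb{M}_k$, $L_X(A)=XA$ and $R_X(A)=AX$ are operators on $\mathcal{H}_k$; for positive semidefinite $X,Y$ they are commuting positive semidefinite operators. For positive semidefinite $X,Y\in\mathbb{M}_k$ define the positive semidefinite operator $\mathbb{J}_f(X,Y):=f(R_XL_Y^{+})L_Y$ on $\mathcal{H}_k$, where $L_Y^+$ is the Moore–Penrose generalized inverse of $L_Y$ and $f$ is applied via functional calculus (with $f(0)=0$). $T^+$ denotes the Moore–Penrose inverse of an operator $T$,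 and $\leq$ is the Loewner order. *)

(* Defs.v *)
From HB Require Import structures.
From mathcomp Require Import all_boot all_order all_algebra.
From mathcomp Require Import complex.
From mathcomp Require Import reals.
From Stdlib Require Import ClassicalEpsilon.

Set Implicit Arguments.
Unset Strict Implicit.
Unset Printing Implicit Defensive.

Import Order.TTheory GRing.Theory Num.Theory Num.Def.
Local Open Scope ring_scope.

Section Defs.
Variable R : realType.
Local Notation C := (R[i]).

Definition adjmx m n (A : 'M[C]_(m, n)) : 'M[C]_(n, m) := map_mx conjC (A^T).

Definition hs n (A B : 'M[C]_n) : C := \tr (adjmx A *m B).

Definition psdmx N (A : 'M[C]_N) : Prop :=
  adjmx A = A /\ forall v : 'rV[C]_N, 0 <= (v *m A *m adjmx v) 0 0.
Definition pdmx N (A : 'M[C]_N) : Prop :=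
  adjmx A = A /\ forall v : 'rV[C]_N, v != 0 -> 0 < (v *m A *m adjmx v) 0 0.
Definition loewner N (A B : 'M[C]_N) : Prop := psdmx (B - A).

Definition penrose N (A B : 'M[C]_N) : Prop :=
  [/\ A *m B *m A = A, B *m A *m B = B,
      adjmx (A *m B) = A *m B & adjmx (B *m A) = B *m A].
Definition mpinv N (A : 'M[C]_N) : 'M[C]_N :=
  epsilon (inhabits (0 : 'M[C]_N)) (penrose A).

(* functional calculus g(A) for a normal (here: Hermitian) matrix A, via the
   spectral decomposition A = P^-1 diag(d) P with P unitary (spectral.v);
   g is applied to the (real) eigenvalues. *)
Definition fcalc (g : R -> R) N (A : 'M[C]_N) : 'M[C]_N :=
  invmx (spectralmx A)
  *m diag_mx (map_mx (fun z : C => (g (complex.Re z))%:C%C) (spectral_diag A))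
  *m spectralmx A.

Definition operator_monotone (f : R -> R) : Prop :=
  forall N (A B : 'M[C]_N), pdmx A -> pdmx B -> loewner A B ->
    loewner (fcalc f A) (fcalc f B).

(* f extended by f(0) = 0 (only values on [0,oo) matter) *)
Definition fext (f : R -> R) (x : R) : R := if 0 < x then f x else 0.

(* Operators on H_k = M_k are represented as matrices in 'M[C]_(k*k) acting on
   row vectors mxvec A on the right: T acts as A |-> vec_mx (mxvec A *m T).
   mxvec is an isometry from (M_k, Hilbert--Schmidt) onto 'rV_(k*k) with the
   standard inner product, so operator adjoint = conjugate transpose, Loewner
   order = loewner, and composition "S then T" = S *m T. *)
Definition opmat m n (g : 'M[C]_m -> 'M[C]_n) : 'M[C]_(m * m, n * n) := lin_mx g.
Definition Lop k (X : 'M[C]_k) : 'M[C]_(k * k) := opmat (mulmx X).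
Definition Rop k (X : 'M[C]_k) : 'M[C]_(k * k) := opmat (fun A => A *m X).

(* J_f(X,Y) = f(R_X L_Y^+) L_Y : first L_Y, then f(R_X L_Y^+), where
   R_X L_Y^+ means first L_Y^+, then R_X. *)
Definition Jf (f : R -> R) k (X Y : 'M[C]_k) : 'M[C]_(k * k) :=
  Lop Y *m fcalc (fext f) (mpinv (Lop Y) *m Rop X).

End Defs.

(* Main.v *)
Require Import Defs.
From HB Require Import structures.
From mathcomp Require Import all_boot all_order all_algebra.
From mathcomp Require Import complex.
From mathcomp Require Import reals.
From mathcomp Require Import ring lra.
From Stdlib Require Import ClassicalEpsilon.

Import Order.TTheory GRing.Theory Num.Theory.
Local Open Scope ring_scope.

(* The operator J_f(X, Y) is the operator mean Q^(1/2) f(Z) Q^(1/2) of the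
   commuting operators Q = L_Y and P = R_X, where Z = Q^-1 P. The Schwarz
   inequality gives phi^* Q phi <= L_(phi^* Y) =: Q' and
   phi^* P phi <= R_(phi^* X) =: P'. If Q' and P' are invertible then
   S = Q^(1/2) phi Q'^(-1/2) is a contraction with S^* Z S <= Z' = Q'^-1 P', and
   (b) becomes Hansen's inequality S^* f(Z) S <= f(Z'): dilate a scalar multiple
   of S to an isometry V, bound diag(Z, delta) by V Z' V^* + M (1 - V V^* ) and
   apply operator monotonicity. The slack comes from scaling S by k < 1; letting
   k tend to 1 is then linear in the result and needs no continuity of f.
   Singular Q', P' are first made invertible off their supports, which contain
   the range of phi^*. Finally (a) follows from (b) by completing a square.
   Operators act on row vectors from the right, so products below appear in the
   order opposite to the usual one. *)

Section MatrixOrder.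
Set Implicit Arguments.
Unset Strict Implicit.
Variable R : realType.
Local Notation C := R[i].

(** * The Loewner order *)

Lemma mulmxK1 m n p (X : 'M[C]_(m, n)) (A : 'M_(n, p)) (B : 'M_(p, n)) :
  A *m B = 1%:M -> X *m A *m B = X.
Proof. by move=> AB; rewrite -mulmxA AB mulmx1. Qed.

Lemma adjmxM m n p (A : 'M[C]_(m, n)) (B : 'M[C]_(n, p)) :
  adjmx (A *m B) = adjmx B *m adjmx A.
Proof. by rewrite /adjmx trmx_mul map_mxM. Qed.

Lemma adjmxK m n (A : 'M[C]_(m, n)) : adjmx (adjmx A) = A.
Proof. by apply/matrixP=> i j; rewrite !mxE conjCK. Qed.

Lemma adjmxD m n (A B : 'M[C]_(m, n)) : adjmx (A + B) = adjmx A + adjmx B.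
Proof. by apply/matrixP=> i j; rewrite !mxE rmorphD. Qed.

Lemma adjmxN m n (A : 'M[C]_(m, n)) : adjmx (- A) = - adjmx A.
Proof. by apply/matrixP=> i j; rewrite !mxE rmorphN. Qed.

Lemma adjmxB m n (A B : 'M[C]_(m, n)) : adjmx (A - B) = adjmx A - adjmx B.
Proof. by rewrite adjmxD adjmxN. Qed.

Lemma adjmxZ m n c (A : 'M[C]_(m, n)) :
  adjmx (c *: A) = Num.conj c *: adjmx A.
Proof. by apply/matrixP=> i j; rewrite !mxE rmorphM. Qed.

Lemma adjmx0 m n : adjmx (0 : 'M[C]_(m, n)) = 0.
Proof. by apply/matrixP=> i j; rewrite !mxE rmorph0. Qed.

Lemma adjmx1 n : adjmx (1%:M : 'M[C]_n) = 1%:M.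
Proof. by apply/matrixP=> i j; rewrite !mxE rmorph_nat eq_sym. Qed.

Lemma conj_realC (a : R) : Num.conj (a%:C%C) = a%:C%C :> C.
Proof. by rewrite conj_Creal // complex_real. Qed.

Lemma adjmx_diagR n (d : 'I_n -> R) :
  adjmx (diag_mx (\row_i (d i)%:C%C) : 'M[C]_n) = diag_mx (\row_i (d i)%:C%C).
Proof.
apply/matrixP=> i j; rewrite !mxE rmorphMn /= conj_realC.
by case: eqVneq => [->|]; rewrite ?eqxx // eq_sym => /negPf ->.
Qed.

Lemma form_diag n (v : 'rV[C]_n) (d : 'rV[C]_n) :
  (v *m diag_mx d *m adjmx v) 0 0 = \sum_i `|v 0 i| ^+ 2 * d 0 i.
Proof.
rewrite mul_mx_diag mxE; apply: eq_bigr => i _.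
by rewrite !mxE normCK mulrAC.
Qed.

Lemma psd_adj n (A : 'M[C]_n) : psdmx A -> adjmx A = A.
Proof. by case. Qed.

Lemma pd_adj n (A : 'M[C]_n) : pdmx A -> adjmx A = A.
Proof. by case. Qed.

Lemma pd_psd n (A : 'M[C]_n) : pdmx A -> psdmx A.
Proof.
case=> hA pA; split=> // v; have [->|/pA/ltW //] := eqVneq v 0.
by rewrite !mul0mx mxE.
Qed.

Lemma psdD n (A B : 'M[C]_n) : psdmx A -> psdmx B -> psdmx (A + B).
Proof.
move=> [hA pA] [hB pB]; split=> [|v]; first by rewrite adjmxD hA hB.
by rewrite mulmxDr mulmxDl mxE addr_ge0.
Qed.

Lemma psdZ n c (A : 'M[C]_n) : 0 <= c -> psdmx A -> psdmx (c *: A).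
Proof.
move=> c0 [hA pA]; split=> [|v].
  by rewrite adjmxZ hA conj_Creal // ger0_real.
by rewrite -scalemxAr -scalemxAl mxE mulr_ge0.
Qed.

Lemma psd_congr m n (S : 'M[C]_(m, n)) (A : 'M[C]_n) :
  psdmx A -> psdmx (S *m A *m adjmx S).
Proof.
move=> [hA pA]; split=> [|v]; first by rewrite !adjmxM adjmxK hA mulmxA.
by have := pA (v *m S); rewrite adjmxM !mulmxA.
Qed.

Lemma psd1 n : psdmx (1%:M : 'M[C]_n).
Proof.
split=> [|v]; first exact: adjmx1.
by rewrite -diag_const_mx form_diag sumr_ge0 // => i _; rewrite mxE mulr1 exprn_ge0.
Qed.

Lemma psd_gram m n (S : 'M[C]_(m, n)) : psdmx (S *m adjmx S).
Proof. by have := psd_congr S (psd1 n); rewrite mulmx1. Qed.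

Lemma loewner_congr m n (S : 'M[C]_(m, n)) (A B : 'M[C]_n) :
  loewner A B -> loewner (S *m A *m adjmx S) (S *m B *m adjmx S).
Proof. by move=> /(psd_congr S); rewrite mulmxBr mulmxBl. Qed.

Lemma loewner_trans n (A B D : 'M[C]_n) :
  loewner A B -> loewner B D -> loewner A D.
Proof.
by move=> h1 h2; have := psdD h1 h2; rewrite addrC addrA subrK.
Qed.

Lemma loewnerD n (A B A' B' : 'M[C]_n) :
  loewner A B -> loewner A' B' -> loewner (A + A') (B + B').
Proof. by move=> h h'; rewrite /loewner opprD addrACA; exact: psdD h h'. Qed.

Lemma loewnerZ n c (A B : 'M[C]_n) :
  0 <= c -> loewner A B -> loewner (c *: A) (c *: B).
Proof. by move=> c0 h; rewrite /loewner -scalerBr; apply: psdZ. Qed.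

Lemma loewner_psd n (A B : 'M[C]_n) : psdmx A -> loewner A B -> psdmx B.
Proof. by move=> hA /(psdD hA); rewrite addrC subrK. Qed.

Lemma loewner_pd n (A B : 'M[C]_n) : pdmx A -> loewner A B -> pdmx B.
Proof.
move=> pA AB; have [hB _] := loewner_psd (pd_psd pA) AB.
split=> // v /(proj2 pA) vA; apply: (lt_le_trans vA).
by have := proj2 AB v; rewrite mulmxBr mulmxBl mxE [X in _ + X]mxE subr_ge0.
Qed.

Lemma form_gram_eq0 n (v : 'rV[C]_n) : (v *m adjmx v) 0 0 = 0 -> v = 0.
Proof.
move=> v0; apply/rowP => i; apply/eqP; rewrite mxE -normr_eq0 -sqrf_eq0.
have := v0; rewrite -{1}[v]mulmx1 -diag_const_mx form_diag => /eqP.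
rewrite psumr_eq0 => [/allP/(_ i (mem_index_enum _))|j _].
  by rewrite mxE mulr1.
by rewrite mxE mulr1 exprn_ge0.
Qed.

(** The form at v is the squared norm of v S; if it vanishes then v S = 0, and multiplying by T
    recovers v = 0. *)
Lemma psd_gram_pd n (S T : 'M[C]_n) :
  S *m T = 1%:M -> pdmx (S *m adjmx S).
Proof.
move=> ST; have [h p] := psd_gram S; split=> // v v0.
rewrite lt_def p andbT; apply: contra v0 => /eqP.
have -> : v *m (S *m adjmx S) *m adjmx v = (v *m S) *m adjmx (v *m S).
  by rewrite adjmxM !mulmxA.
move=> /form_gram_eq0 /(congr1 (mulmx^~ T)).
by rewrite -mulmxA ST mulmx1 mul0mx => ->.
Qed.

(** * Functional calculus *)

Definition eigval n (A : 'M[C]_n) (i : 'I_n) : R :=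
  complex.Re (spectral_diag A 0 i).

Lemma spectral_mulr n (A : 'M[C]_n) :
  spectralmx A *m adjmx (spectralmx A) = 1%:M.
Proof. exact/unitarymxP/spectral_unitarymx. Qed.

Lemma spectral_mull n (A : 'M[C]_n) :
  adjmx (spectralmx A) *m spectralmx A = 1%:M.
Proof. exact/mulmx1C/spectral_mulr. Qed.

Lemma fcalcE g n (A : 'M[C]_n) :
  fcalc g A = adjmx (spectralmx A)
    *m diag_mx (\row_i (g (eigval A i))%:C%C) *m spectralmx A.
Proof.
rewrite /fcalc (invmx_unitary (spectral_unitarymx A)).
by congr (_ *m diag_mx _ *m _); apply/rowP=> i; rewrite !mxE.
Qed.

Lemma fcalc_id n (A : 'M[C]_n) : adjmx A = A -> fcalc id A = A.
Proof.
move=> hA; have hsA : A \is hermsymmx.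
  by apply/is_hermitianmxP; rewrite expr0 scale1r -[LHS]hA.
rewrite [RHS](orthomx_spectralP (hermitian_normalmx hsA)).
congr (_ *m diag_mx _ *m _); apply/rowP=> i; rewrite [LHS]mxE.
by apply: RRe_real; have /mxOverP := hermitian_spectral_diag_real hsA; apply.
Qed.

Lemma eq_fcalc g h n (A : 'M[C]_n) :
  (forall i, g (eigval A i) = h (eigval A i)) -> fcalc g A = fcalc h A.
Proof.
move=> gh; rewrite !fcalcE; congr (_ *m diag_mx _ *m _).
by apply/rowP=> i; rewrite !mxE gh.
Qed.

Lemma fcalc_adj g n (A : 'M[C]_n) : adjmx (fcalc g A) = fcalc g A.
Proof. by rewrite fcalcE !adjmxM adjmxK adjmx_diagR mulmxA. Qed.

Lemma fcalcM g h n (A : 'M[C]_n) :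
  fcalc g A *m fcalc h A = fcalc (fun x => g x * h x) A.
Proof.
rewrite !fcalcE !mulmxA -[_ *m spectralmx A *m adjmx _]mulmxA spectral_mulr.
rewrite mulmx1 -[_ *m diag_mx _ *m diag_mx _]mulmxA mulmx_diag.
by congr (_ *m diag_mx _ *m _); apply/rowP=> i; rewrite !mxE rmorphM.
Qed.

Lemma mul_fcalc g n (A : 'M[C]_n) : adjmx A = A ->
  A *m fcalc g A = fcalc (fun x => x * g x) A.
Proof. by move=> hA; have := fcalcM id g A; rewrite fcalc_id. Qed.

Lemma fcalc_mul g n (A : 'M[C]_n) : adjmx A = A ->
  fcalc g A *m A = fcalc (fun x => g x * x) A.
Proof. by move=> hA; have := fcalcM g id A; rewrite fcalc_id. Qed.

Lemma eq_fcalc_id g n (A : 'M[C]_n) : adjmx A = A ->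
  (forall i, g (eigval A i) = eigval A i) -> fcalc g A = A.
Proof. by move=> hA gid; rewrite (@eq_fcalc g id) ?fcalc_id. Qed.

Lemma fcalcB g h n (A : 'M[C]_n) :
  fcalc g A - fcalc h A = fcalc (fun x => g x - h x) A.
Proof.
rewrite !fcalcE -mulmxBl -mulmxBr -linearB /=.
by congr (_ *m diag_mx _ *m _); apply/rowP=> i; rewrite !mxE rmorphB.
Qed.

Lemma fcalc_const c n (A : 'M[C]_n) : fcalc (fun=> c) A = (c%:C%C)%:M.
Proof.
rewrite fcalcE (_ : diag_mx _ = (c%:C%C)%:M); last first.
  by rewrite -diag_const_mx; congr diag_mx; apply/rowP=> i; rewrite !mxE.
by rewrite mul_mx_scalar -scalemxAl spectral_mull scalemx1.
Qed.

Lemma psd_fcalc (g : R -> R) n (A : 'M[C]_n) :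
  (forall i, 0 <= g (eigval A i)) -> psdmx (fcalc g A).
Proof.
move=> g0; split=> [|v]; first exact: fcalc_adj.
rewrite fcalcE.
have := form_diag (v *m adjmx (spectralmx A)) (\row_i (g (eigval A i))%:C%C).
rewrite adjmxM adjmxK !mulmxA => ->.
apply: sumr_ge0 => i _; rewrite [X in _ * X]mxE.
by apply: mulr_ge0; [apply: exprn_ge0|rewrite ler0c].
Qed.

(** The rows of [spectralmx A] are unit eigenvectors. This turns positivity of the form into
    positivity of the eigenvalues. *)
Lemma form_eigval n (A : 'M[C]_n) i : adjmx A = A ->
  (row i (spectralmx A) *m A *m adjmx (row i (spectralmx A))) 0 0
  = (eigval A i)%:C%C.
Proof.
move=> /fcalc_id {2}<-; rewrite fcalcE rowE adjmxM.
rewrite !mulmxA -[_ *m spectralmx A *m adjmx _]mulmxA spectral_mulr mulmx1.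
rewrite -[_ *m spectralmx A *m adjmx _]mulmxA spectral_mulr mulmx1.
rewrite form_diag (bigD1 i) //= !mxE !eqxx normr1 expr1n mul1r big1 ?addr0 //.
by move=> j ji; rewrite !mxE eqxx (negPf ji) normr0 expr0n mul0r.
Qed.

Lemma eigval_ge0 n (A : 'M[C]_n) i : psdmx A -> 0 <= eigval A i.
Proof. by case=> hA pA; rewrite -ler0c -form_eigval //; apply: pA. Qed.

Lemma eigval_gt0 n (A : 'M[C]_n) i : pdmx A -> 0 < eigval A i.
Proof.
case=> hA pA; rewrite -ltcR -form_eigval //; apply: pA.
(* A zero row would contradict the diagonal entry 1 of the unitarity relation. *)
apply/negP => /eqP r0; have := congr1 (row i) (spectral_mulr A).
rewrite row_mul r0 mul0mx => /rowP/(_ i); rewrite !mxE eqxx => /esym/eqP.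
by rewrite oner_eq0.
Qed.

(* In eigenbases the entry w_ij of W satisfies a_i w_ij = w_ij b_j, so that
   w_ij = 0 unless a_i = b_j. *)
Lemma fcalc_intertwine g m n (A : 'M[C]_m) (B : 'M[C]_n) (W : 'M[C]_(m, n)) :
  adjmx A = A -> adjmx B = B -> A *m W = W *m B ->
  fcalc g A *m W = W *m fcalc g B.
Proof.
move=> /fcalc_id hA /fcalc_id hB AW; rewrite -{1}hA -{1}hB !fcalcE in AW.
have [W' W'E] : exists W', W' = spectralmx A *m W *m adjmx (spectralmx B).
  by eexists.
have WE : W = adjmx (spectralmx A) *m W' *m spectralmx B.
  by rewrite W'E !mulmxA spectral_mull mul1mx mulmxK1 // spectral_mull.
rewrite !fcalcE.
(* This equivalence is used twice: on the hypothesis, with the eigenvalues on the diagonals, and on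
   the goal, with their images under g. *)
have E (D : 'M_m) (D' : 'M_n) :
    (adjmx (spectralmx A) *m D *m spectralmx A *m W =
     W *m (adjmx (spectralmx B) *m D' *m spectralmx B)) <-> D *m W' = W' *m D'.
  split=> [|DW].
    move=> /(congr1 (fun M => spectralmx A *m M *m adjmx (spectralmx B))).
    rewrite W'E !mulmxA spectral_mulr mul1mx => ->.
    by rewrite mulmxK1 // spectral_mulr.
  rewrite WE !mulmxA mulmxK1 ?spectral_mulr //.
  rewrite [_ *m spectralmx B *m adjmx _]mulmxK1 ?spectral_mulr //.
  by rewrite -[adjmx _ *m D *m W']mulmxA DW mulmxA.
apply/E; move/E in AW; move: W' AW {WE E W'E} => W' AW.
apply/matrixP => i j; move/matrixP/(_ i j): AW.
rewrite !mul_diag_mx !mul_mx_diag !mxE => aw.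
have [->|w0] := eqVneq (W' i j) 0; first by rewrite mulr0 mul0r.
have : eigval A i = eigval B j.
  by apply: (@complexI R); apply: (mulIf w0); rewrite aw mulrC.
by move=> ->; rewrite mulrC.
Qed.

(** * Moore-Penrose inverses, square roots and spectral bounds *)

Lemma penrose_uniq n (A B B' : 'M[C]_n) :
  penrose A B -> penrose A B' -> B = B'.
Proof.
move=> [ABA BAB hAB hBA] [AB'A B'AB' hAB' hB'A].
(* A B and A B' are Hermitian projections with the same range; taking the adjoint of A B = (A B') (A
   B) exchanges the factors and yields A B'. *)
have AB : A *m B = A *m B'.
  have h : A *m B = (A *m B') *m (A *m B) by rewrite !mulmxA AB'A.
  by rewrite -hAB h adjmxM hAB hAB' !mulmxA ABA.
have BA : B *m A = B' *m A.
  have h : B *m A = (B *m A) *m (B' *m A) by rewrite -mulmxA [A *m (_ *m _)]mulmxA AB'A.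
  by rewrite -hBA h adjmxM hBA hB'A -mulmxA [A *m (_ *m _)]mulmxA ABA.
by rewrite -BAB BA -mulmxA AB mulmxA.
Qed.

(** The convention 0^-1 = 0 makes the scalar inverse act as the generalized inverse on each
    eigenvalue. This provides the witness that the choice in [mpinv] requires. *)
Lemma penrose_fcalc n (A : 'M[C]_n) : adjmx A = A ->
  penrose A (fcalc (@GRing.inv R) A).
Proof.
move=> hA; split.
- rewrite mul_fcalc // fcalc_mul //; apply: eq_fcalc_id => // i.
  by have [->|x0] := eqVneq (eigval A i) 0; rewrite ?mulr0 // mulfV // mul1r.
- rewrite fcalc_mul // fcalcM; apply: eq_fcalc => i.
  by have [->|x0] := eqVneq (eigval A i) 0; rewrite ?invr0 ?mulr0 ?mulVf ?mul1r.
- by rewrite mul_fcalc // fcalc_adj.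
- by rewrite fcalc_mul // fcalc_adj.
Qed.

Lemma mpinvP n (A : 'M[C]_n) : adjmx A = A -> penrose A (mpinv A).
Proof.
move=> /penrose_fcalc P.
exact: (@epsilon_spec _ (inhabits (0 : 'M[C]_n)) _ (ex_intro _ _ P)).
Qed.

Lemma mpinvE n (A : 'M[C]_n) : adjmx A = A -> mpinv A = fcalc (@GRing.inv R) A.
Proof.
by move=> hA; apply: penrose_uniq (mpinvP hA) (penrose_fcalc hA).
Qed.

Lemma mpinv_adj n (A : 'M[C]_n) : adjmx A = A -> adjmx (mpinv A) = mpinv A.
Proof. by move=> hA; rewrite mpinvE // fcalc_adj. Qed.

Lemma psd_sqrt n (A : 'M[C]_n) : psdmx A ->
  fcalc Num.sqrt A *m fcalc Num.sqrt A = A.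
Proof.
move=> pA; rewrite fcalcM; apply: eq_fcalc_id => [|i]; first exact: psd_adj.
by rewrite -expr2 sqr_sqrtr // eigval_ge0.
Qed.

Lemma herm_bounded n (A : 'M[C]_n) : adjmx A = A ->
  exists2 M : R, 0 <= M & loewner A (M%:C%C)%:M.
Proof.
move=> hA; exists (\sum_i `|eigval A i|); first by apply: sumr_ge0.
have := fcalcB (fun=> \sum_i `|eigval A i|) id A.
rewrite fcalc_const fcalc_id // /loewner => ->.
apply: psd_fcalc => i; rewrite subr_ge0 (bigD1 i) //=.
by rewrite (le_trans (ler_norm _)) // lerDl sumr_ge0.
Qed.

Lemma pd_lower_bound n (A : 'M[C]_n) : pdmx A ->
  exists2 c : R, 0 < c & loewner (c%:C%C)%:M A.
Proof.
(* The default value 1 keeps the minimum positive when n = 0. *)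
move=> pA; exists (\big[Num.min/1]_i eigval A i).
  by apply: lt_bigmin => // i _; apply: eigval_gt0.
have := fcalcB id (fun=> \big[Num.min/1]_i eigval A i) A.
rewrite fcalc_const fcalc_id ?pd_adj // /loewner => ->.
by apply: psd_fcalc => i; rewrite subr_ge0 bigmin_le_cond.
Qed.

Lemma pd_scalar n (c : R) : 0 < c -> pdmx ((c%:C%C)%:M : 'M[C]_n).
Proof.
move=> c0; have [h p] : psdmx ((c%:C%C)%:M : 'M[C]_n).
  by rewrite -scalemx1; apply: psdZ; rewrite ?ler0c ?(ltW c0) //; apply: psd1.
split=> // v v0; rewrite lt_def p andbT; apply: contra v0 => /eqP.
rewrite mul_mx_scalar -scalemxAl mxE => /eqP.
rewrite mulf_eq0 eq_complex /= (gt_eqF c0) /= => /eqP/form_gram_eq0 ->.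
by rewrite eqxx.
Qed.

(** A weighted arithmetic-geometric inequality for the off-diagonal blocks, as an identity: for e >
    0, A positive semidefinite and P, Q Hermitian, the right side is positive semidefinite. *)
Lemma pinch_identity n (A P Q : 'M[C]_n) (e : C) : P + Q = 1%:M -> e != 0 ->
  (1 + e) *: (P *m A *m P) + (1 + e^-1) *: (Q *m A *m Q) - A =
  e^-1 *: ((e *: P - Q) *m A *m (e *: P - Q)).
Proof.
move=> PQ e0; have {3}-> : A = (P + Q) *m A *m (P + Q) by rewrite PQ mul1mx mulmx1.
rewrite [(P + Q) *m A]mulmxDl mulmxDr 2!mulmxDl.
rewrite [(_ - Q) *m A]mulmxBl mulmxBr 2!mulmxBl -!scalemxAl -!scalemxAr.
move: (P *m A *m P) (P *m A *m Q) (Q *m A *m P) (Q *m A *m Q).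
by move=> a1 a2 a3 a4; apply/matrixP=> i j; rewrite !mxE; field.
Qed.

Lemma pd_fcalc (g : R -> R) n (A : 'M[C]_n) :
  (forall i, 0 < g (eigval A i)) -> pdmx (fcalc g A).
Proof.
move=> g0; pose S := fcalc (fun x => Num.sqrt (g x)) A.
have -> : fcalc g A = S *m adjmx S.
  rewrite fcalc_adj fcalcM; apply: eq_fcalc => i.
  by rewrite -expr2 sqr_sqrtr ?ltW.
apply: (@psd_gram_pd _ _ (fcalc (fun x => (Num.sqrt (g x))^-1) A)).
rewrite fcalcM -(rmorph1 (real_complex R)) -(fcalc_const 1 A).
by apply: eq_fcalc => i; rewrite mulfV // gt_eqF // sqrtr_gt0.
Qed.

Lemma pd_congr n (S T A : 'M[C]_n) :
  S *m T = 1%:M -> pdmx A -> pdmx (S *m A *m adjmx S).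
Proof.
move=> ST pA; have [h _] := psd_congr S (pd_psd pA); split=> // v v0.
have := proj2 pA (v *m S); rewrite adjmxM !mulmxA; apply.
apply: contra v0 => /eqP /(congr1 (mulmx^~ T)).
by rewrite -mulmxA ST mulmx1 mul0mx => ->.
Qed.

(** A nonzero row of S would give the form of A a value both positive and at most 0. *)
Lemma loewner_congr0 m n (S : 'M[C]_(m, n)) (A : 'M[C]_n) :
  pdmx A -> loewner (S *m A *m adjmx S) 0 -> S = 0.
Proof.
move=> pA [_ SA]; apply/row_matrixP => i; rewrite row0 rowE.
apply/eqP; apply: contraT => v0.
have := SA (delta_mx 0 i); rewrite sub0r mulmxN mulNmx mxE oppr_ge0.
have := proj2 pA _ v0; rewrite adjmxM !mulmxA => v1 v2.
by have := lt_le_trans v1 v2; rewrite ltxx.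
Qed.

(** * Hansen's inequality *)

Section OperatorMonotone.
Variable f : R -> R.
Hypothesis f_pos : forall x : R, 0 < x -> 0 < f x.
Hypothesis f_om : operator_monotone f.

Lemma psd_fcalc_pos n (A : 'M[C]_n) : pdmx A -> psdmx (fcalc f A).
Proof. by move=> pA; apply: psd_fcalc => i; rewrite ltW // f_pos // eigval_gt0. Qed.

(* The block operator V^* B V + M (1 - V^* V) dominates A for large M, because
   the off-diagonal blocks of A are absorbed by the factor 1 + e. *)
Lemma isometry_fcalc p q (V : 'M[C]_(q, p)) (A : 'M[C]_p) (B : 'M[C]_q) (e : R) :
  0 < e -> V *m adjmx V = 1%:M -> pdmx A -> adjmx B = B ->
  loewner ((1 + e)%:C%C *: (V *m A *m adjmx V)) B ->
  loewner (V *m fcalc f A *m adjmx V) (fcalc f B).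
Proof.
move=> e0 VV pA hB AB.
have [M M0 AM] := herm_bounded (pd_adj pA).
pose P := adjmx V *m V; pose P' := 1%:M - P.
have hP : adjmx P = P by rewrite adjmxM adjmxK.
have hP' : adjmx P' = P' by rewrite adjmxB adjmx1 hP.
have PP : P *m P = P by rewrite /P mulmxA -[_ *m V *m _]mulmxA VV mulmx1.
have PP' : P' *m P' = P'.
  by rewrite /P' mulmxBl mul1mx mulmxBr mulmx1 PP subrr subr0.
pose c := (1 + e^-1)%:C%C : C.
have c0 : 0 <= c by rewrite ler0c addr_ge0 ?invr_ge0 ?ltW.
have pinch : loewner A ((1 + e)%:C%C *: (P *m A *m P) + c *: (P' *m A *m P')).
  have PP1 : P + P' = 1%:M by rewrite addrC subrK.
  rewrite /loewner /c !rmorphD !rmorph1 fmorphV.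
  have eC0 : e%:C%C != 0 :> C by rewrite eq_complex /= (gt_eqF e0).
  rewrite (pinch_identity A PP1 eC0).
  have := psd_congr (e%:C%C *: P - P') (pd_psd pA).
  rewrite adjmxB adjmxZ hP hP' conj_realC; apply: psdZ.
  by rewrite -fmorphV ler0c invr_ge0 ltW.
pose B1 := adjmx V *m B *m V + (c * M%:C%C) *: P'.
have AB1 : loewner A B1.
  apply: loewner_trans pinch _; apply: loewnerD.
    have := loewner_congr (adjmx V) AB; rewrite adjmxK.
    by rewrite -scalemxAr -scalemxAl /P !mulmxA.
  rewrite -scalerA; apply: loewnerZ c0 _.
  have := loewner_congr P' AM; rewrite hP'.
  by rewrite mul_mx_scalar -scalemxAl PP'.
have pB1 := loewner_pd pA AB1.
(* V intertwines B with B1, so compressing f(B1) by V returns exactly f(B). *)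
have VB : B *m V = V *m B1.
  rewrite mulmxDr -scalemxAr /P' /P mulmxBr !mulmxA VV !mul1mx mulmx1 subrr.
  by rewrite scaler0 addr0.
have := loewner_congr V (f_om pA pB1 AB1).
clearbody B1; rewrite -(fcalc_intertwine f hB (pd_adj pB1) VB).
by rewrite -[fcalc f B *m V *m _]mulmxA VV mulmx1.
Qed.

(** Put S1 = k S, let D be the square root of the defect 1 - S1 S1^*, and V = [S1 D], so that V V^*
    = 1. Then V diag(Z, d) V^* = S1 Z S1^* + d D D^* is at most k^2 Z' + k (1 - k) Z' = k Z', which
    leaves the factor 1/k > 1 that [isometry_fcalc] asks for. *)
Lemma contraction_fcalc_scaled p q (S : 'M[C]_(q, p)) (Z : 'M[C]_p)
    (Z' : 'M[C]_q) (k : R) :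
  0 < k < 1 -> pdmx Z -> pdmx Z' -> loewner (S *m adjmx S) 1%:M ->
  loewner (S *m Z *m adjmx S) Z' ->
  loewner ((k ^+ 2)%:C%C *: (S *m fcalc f Z *m adjmx S)) (fcalc f Z').
Proof.
move=> /andP[k0 k1] pZ pZ' SS SZ.
have [c c0 cZ'] := pd_lower_bound pZ'.
have k2 : 0 <= (k ^+ 2)%:C%C :> C by rewrite ler0c exprn_ge0 ?ltW.
have [S1 kE] : exists S1, forall X : 'M[C]_p,
    S1 *m X *m adjmx S1 = (k ^+ 2)%:C%C *: (S *m X *m adjmx S).
  exists (k%:C%C *: S) => X.
  by rewrite adjmxZ conj_realC -!scalemxAl -scalemxAr scalerA -rmorphM expr2.
have S1S1 : psdmx (1%:M - S1 *m adjmx S1).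
  have := kE 1%:M; rewrite !mulmx1 => ->.
  apply: loewner_trans (loewnerZ k2 SS) _.
  rewrite /loewner -{1}[1%:M]scale1r -scalerBl; apply: psdZ (psd1 _).
  by rewrite -(rmorph1 (real_complex R)) -rmorphB ler0c subr_ge0 exprn_ile1 ?ltW.
pose D := fcalc Num.sqrt (1%:M - S1 *m adjmx S1).
have hD : adjmx D = D by apply: fcalc_adj.
have DD : D *m adjmx D = 1%:M - S1 *m adjmx S1 by rewrite hD psd_sqrt.
have DD1 : loewner (D *m adjmx D) 1%:M.
  by rewrite DD /loewner opprB addrCA subrr addr0; apply: psd_gram.
pose V : 'M[C]_(q, p + q) := row_mx S1 D.
have adjV : adjmx V = col_mx (adjmx S1) (adjmx D).
  by rewrite /adjmx tr_row_mx map_col_mx.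
have VV : V *m adjmx V = 1%:M by rewrite adjV mul_row_col DD addrC subrK.
(* Since c is a lower bound of Z' and D D^* is at most 1, d D D^* is at most k (1 - k) Z'. *)
pose d := c * (k * (1 - k)).
have d0 : 0 < d by rewrite !mulr_gt0 // subr_gt0.
have pd' := pd_scalar q d0.
pose A : 'M[C]_(p + q) := block_mx Z 0 0 (d%:C%C)%:M.
have pA : pdmx A.
  have adjA : adjmx A = A.
    by rewrite /adjmx tr_block_mx map_block_mx /= -!/(adjmx _) !adjmx0 !pd_adj.
  split=> // v; rewrite -[v]hsubmxK; set v1 := lsubmx v; set v2 := rsubmx v.
  have -> : adjmx (row_mx v1 v2) = col_mx (adjmx v1) (adjmx v2).
    by rewrite /adjmx tr_row_mx map_col_mx.
  rewrite mul_row_block !mulmx0 addr0 add0r mul_row_col mxE => v0.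
  have [v10|v10] := eqVneq v1 0; last first.
    by rewrite ltr_wpDr //; [apply: (proj2 (pd_psd pd'))|apply: (proj2 pZ)].
  rewrite ltr_wpDl //; [exact: (proj2 (pd_psd pZ))|apply: (proj2 pd')].
  by apply: contra v0 => /eqP ->; rewrite v10 row_mx0.
have VA g : V *m fcalc g A *m adjmx V =
    S1 *m fcalc g Z *m adjmx S1 + D *m fcalc g (d%:C%C)%:M *m adjmx D.
  (* The two block inclusions intertwine Z and d with A, which gives the blocks of g(A) without
     diagonalizing A explicitly. *)
  pose U1 : 'M[C]_(p, p + q) := row_mx 1%:M 0.
  pose U2 : 'M[C]_(q, p + q) := row_mx 0 1%:M.
  have U1A : Z *m U1 = U1 *m A.
    by rewrite /U1 /A mul_row_block !mul1mx !mul0mx !addr0 mul_mx_row mulmx1 mulmx0.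
  have U2A : (d%:C%C)%:M *m U2 = U2 *m A.
    by rewrite /U2 /A mul_row_block !mul1mx !mul0mx !add0r mul_mx_row mulmx1 mulmx0.
  have VE : V = S1 *m U1 + D *m U2.
    by rewrite /U1 /U2 !mul_mx_row !mulmx0 !mulmx1 add_row_mx addr0 add0r.
  rewrite {1}VE mulmxDl -[S1 *m U1 *m _]mulmxA -[D *m U2 *m _]mulmxA.
  rewrite -(fcalc_intertwine g (pd_adj pZ) (pd_adj pA) U1A).
  rewrite -(fcalc_intertwine g (pd_adj pd') (pd_adj pA) U2A).
  rewrite mulmxDl !mulmxA -[_ *m U1 *m _]mulmxA -[_ *m U2 *m _]mulmxA.
  have -> : U1 *m adjmx V = adjmx S1.
    by rewrite adjV mul_row_col mul1mx mul0mx addr0.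
  have -> : U2 *m adjmx V = adjmx D.
    by rewrite adjV mul_row_col mul1mx mul0mx add0r.
  by [].
(* Here e is chosen so that 1 + e = 1/k. *)
have e0 : 0 < k^-1 - 1 by rewrite subr_gt0 invf_gt1.
have := isometry_fcalc e0 VV pA (pd_adj pZ').
rewrite addrC subrK VA kE => H; apply: loewner_trans (H _).
  rewrite /loewner addrAC subrr add0r; apply: psd_congr; exact: psd_fcalc_pos.
have := VA id.
rewrite (fcalc_id (pd_adj pA)) (fcalc_id (pd_adj pZ)) (fcalc_id (pd_adj pd')).
rewrite kE => ->.
have H1 : loewner
    ((k ^+ 2)%:C%C *: (S *m Z *m adjmx S) + D *m (d%:C%C)%:M *m adjmx D)
    ((k ^+ 2)%:C%C *: Z' + (k * (1 - k))%:C%C *: Z').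
  apply: loewnerD; first exact: loewnerZ.
  rewrite mul_mx_scalar -scalemxAl rmorphM [_ * _%:C%C]mulrC -scalerA.
  apply: loewnerZ; first by rewrite ler0c mulr_ge0 ?subr_ge0 ?ltW.
  apply: loewner_trans cZ'; rewrite -scalemx1; apply: loewnerZ DD1.
  by rewrite ler0c ltW.
have := @loewnerZ _ (k^-1)%:C%C _ _ _ H1.
rewrite ler0c invr_ge0 (ltW k0) => /(_ isT).
rewrite -scalerDl -rmorphD scalerA -rmorphM.
have -> : k^-1 * (k ^+ 2 + k * (1 - k)) = 1.
  by have := gt_eqF k0; move=> /negbT kn0; field.
rewrite (rmorph1 (real_complex R)) scale1r; exact: id.
Qed.

(** The passage k -> 1, made for each vector separately: the forms of A and B take nonnegative real
    values a and b, and a single well-chosen k refutes a > b. *)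
Lemma scaled_loewner n (A B : 'M[C]_n) : psdmx A ->
  (forall k : R, 0 < k < 1 -> loewner ((k ^+ 2)%:C%C *: A) B) -> loewner A B.
Proof.
move=> [hA pA] AB.
have h2 : 0 < (2^-1 : R) < 1 by rewrite invr_gt0 ltr0n invf_lt1 ?ltr1n ?ltr0n.
have [hB pB] : psdmx B.
  apply: loewner_psd (AB _ h2); apply: psdZ => //.
  by rewrite ler0c exprn_ge0 ?invr_ge0.
split=> [|v]; first by rewrite adjmxB hA hB.
rewrite mulmxBr mulmxBl mxE [X in _ + X]mxE subr_ge0.
have H k : 0 < k < 1 ->
    (k ^+ 2)%:C%C * (v *m A *m adjmx v) 0 0 <= (v *m B *m adjmx v) 0 0.
  move=> /AB[_ /(_ v)].
  rewrite mulmxBr mulmxBl mxE [X in _ + X]mxE subr_ge0.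
  by rewrite -scalemxAr -scalemxAl mxE.
move: (pA v) (pB v) H; move: ((v *m A *m adjmx v) 0 0) ((v *m B *m adjmx v) 0 0).
move=> x y /[dup] x0 /ger0_real/complex_realP[a xa].
move=> /[dup] y0 /ger0_real/complex_realP[b yb].
rewrite {}xa {}yb !ler0c lecR in x0 y0 * => H.
rewrite leNgt; apply/negP => ba.
have a0 : 0 < a by apply: le_lt_trans ba.
(* With this k, k^2 a <= b becomes (a + b)^2 <= 4 a b, contradicting (a - b)^2 > 0. *)
pose k := (a + b) / (2 * a).
have ak : a * k = (a + b) / 2 by rewrite /k; field; rewrite gt_eqF.
have k01 : 0 < k < 1.
  by rewrite /k divr_gt0 ?ltr_pdivrMr //; nra.
have := H k k01; rewrite -rmorphM lecR => kab.
have : 4 * (a * k) ^+ 2 <= 4 * a * b.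
  have -> : 4 * (a * k) ^+ 2 = 4 * a * (k ^+ 2 * a) by ring.
  by rewrite ler_pM2l // mulr_gt0.
rewrite ak => h; have : 0 < (a - b) ^+ 2 by rewrite exprn_gt0 // subr_gt0.
by have -> : (a - b) ^+ 2 = 4 * ((a + b) / 2) ^+ 2 - 4 * a * b; [field|lra].
Qed.

Lemma contraction_fcalc p q (S : 'M[C]_(q, p)) (Z : 'M[C]_p) (Z' : 'M[C]_q) :
  pdmx Z -> pdmx Z' -> loewner (S *m adjmx S) 1%:M ->
  loewner (S *m Z *m adjmx S) Z' ->
  loewner (S *m fcalc f Z *m adjmx S) (fcalc f Z').
Proof.
move=> pZ pZ' SS SZ; apply: scaled_loewner => [|k k01].
  exact/psd_congr/psd_fcalc_pos.
exact: contraction_fcalc_scaled.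
Qed.

End OperatorMonotone.

Local Opaque psdmx pdmx fcalc mpinv.

Lemma fcalc_comm (g : R -> R) n (A W : 'M[C]_n) : adjmx A = A ->
  A *m W = W *m A -> fcalc g A *m W = W *m fcalc g A.
Proof. by move=> hA; apply: fcalc_intertwine. Qed.

Lemma fcalc_comm2 (g h : R -> R) n (A B : 'M[C]_n) :
  adjmx A = A -> adjmx B = B -> A *m B = B *m A ->
  fcalc g A *m fcalc h B = fcalc h B *m fcalc g A.
Proof. by move=> hA hB AB; apply/fcalc_comm/esym/fcalc_comm/esym. Qed.

Lemma sqrt_mulV n (A : 'M[C]_n) : pdmx A ->
  fcalc Num.sqrt A *m fcalc (fun x => (Num.sqrt x)^-1) A = 1%:M.
Proof.
move=> pA; rewrite fcalcM -(rmorph1 (real_complex R)) -(fcalc_const 1 A).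
by apply: eq_fcalc => i; rewrite mulfV // gt_eqF // sqrtr_gt0 eigval_gt0.
Qed.

Lemma mul_mpinv n (A : 'M[C]_n) : pdmx A -> A *m mpinv A = 1%:M.
Proof.
move=> pA; rewrite (mpinvE (pd_adj pA)) (mul_fcalc _ (pd_adj pA)).
rewrite -(rmorph1 (real_complex R)) -(fcalc_const 1 A).
by apply: eq_fcalc => i; rewrite mulfV // gt_eqF // eigval_gt0.
Qed.

Lemma pd_mpinv n (A : 'M[C]_n) : pdmx A -> pdmx (mpinv A).
Proof.
move=> pA; rewrite (mpinvE (pd_adj pA)).
by apply: pd_fcalc => i; rewrite invr_gt0 eigval_gt0.
Qed.

Lemma mpinv_comm n (A W : 'M[C]_n) : adjmx A = A ->
  A *m W = W *m A -> mpinv A *m W = W *m mpinv A.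
Proof. by move=> hA; rewrite (mpinvE hA); apply: fcalc_comm. Qed.

(** By commutation A B = A^(1/2) B A^(1/2), an invertible congruence of B. *)
Lemma pd_mul_comm n (A B : 'M[C]_n) : pdmx A -> pdmx B ->
  A *m B = B *m A -> pdmx (A *m B).
Proof.
move=> pA pB AB; have := pd_congr (sqrt_mulV pA) pB.
rewrite fcalc_adj -mulmxA -(fcalc_comm _ (pd_adj pA) AB) mulmxA.
by rewrite (psd_sqrt (pd_psd pA)).
Qed.

(** * Operator means of commuting matrices *)

Section OperatorMean.
Variable f : R -> R.
Hypothesis f_pos : forall x : R, 0 < x -> 0 < f x.
Hypothesis f_om : operator_monotone f.

Lemma fcalc_fext n (A : 'M[C]_n) : pdmx A -> fcalc (fext f) A = fcalc f A.
Proof. by move=> pA; apply: eq_fcalc => i; rewrite /fext eigval_gt0. Qed.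

(** [Jf f X Y] is this expression at Q = [Lop Y] and P = [Rop X], by unfolding. *)
Definition opmean n (Q P : 'M[C]_n) : 'M[C]_n :=
  Q *m fcalc (fext f) (mpinv Q *m P).

Lemma pd_quot n (Q P : 'M[C]_n) : pdmx Q -> pdmx P ->
  Q *m P = P *m Q -> pdmx (mpinv Q *m P).
Proof.
move=> pQ pP QP; apply: pd_mul_comm (pd_mpinv pQ) pP _.
exact: mpinv_comm (pd_adj pQ) QP.
Qed.

(** Q commutes with Z = Q^-1 P, so Q^(1/2) commutes with f(Z). The symmetric form is a congruence,
    which the Loewner order respects. *)
Lemma opmeanE n (Q P : 'M[C]_n) : pdmx Q -> pdmx P -> Q *m P = P *m Q ->
  opmean Q P =
  fcalc Num.sqrt Q *m fcalc f (mpinv Q *m P) *m adjmx (fcalc Num.sqrt Q).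
Proof.
move=> pQ pP QP; have pZ := pd_quot pQ pP QP.
rewrite /opmean (fcalc_fext pZ) fcalc_adj.
have QZ : Q *m (mpinv Q *m P) = (mpinv Q *m P) *m Q.
  by rewrite mulmxA -(mpinv_comm (pd_adj pQ) (erefl (Q *m Q))) -!mulmxA QP.
have QfZ := fcalc_comm f (pd_adj pZ) (esym QZ).
rewrite -mulmxA -(fcalc_comm _ (pd_adj pQ) (esym QfZ)) mulmxA.
by rewrite (psd_sqrt (pd_psd pQ)).
Qed.

Lemma pd_opmean n (Q P : 'M[C]_n) : pdmx Q -> pdmx P -> Q *m P = P *m Q ->
  pdmx (opmean Q P).
Proof.
move=> pQ pP QP; rewrite (opmeanE pQ pP QP); apply: pd_congr (sqrt_mulV pQ) _.
by apply: pd_fcalc => i; apply/f_pos/eigval_gt0/pd_quot.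
Qed.

Lemma opmean_transformer_pd p q (T : 'M[C]_(q, p)) (Q P : 'M[C]_p)
    (Q' P' : 'M[C]_q) :
  pdmx Q -> pdmx P -> Q *m P = P *m Q ->
  pdmx Q' -> pdmx P' -> Q' *m P' = P' *m Q' ->
  loewner (T *m Q *m adjmx T) Q' -> loewner (T *m P *m adjmx T) P' ->
  loewner (T *m opmean Q P *m adjmx T) (opmean Q' P').
Proof.
move=> pQ pP QP pQ' pP' QP' TQ TP.
rewrite (opmeanE pQ pP QP) (opmeanE pQ' pP' QP').
set Z := mpinv Q *m P; set Z' := mpinv Q' *m P'.
pose K := fcalc Num.sqrt Q; pose K' := fcalc Num.sqrt Q'.
pose L' := fcalc (fun x => (Num.sqrt x)^-1) Q'.
have hK : adjmx K = K by apply: fcalc_adj.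
have hL' : adjmx L' = L' by apply: fcalc_adj.
have KK : K *m K = Q by apply/psd_sqrt/pd_psd.
have KL' : K' *m L' = 1%:M by apply: sqrt_mulV.
have LK' : L' *m K' = 1%:M by apply: mulmx1C.
have LL' : L' *m L' = mpinv Q'.
  rewrite fcalcM (mpinvE (pd_adj pQ')); apply: eq_fcalc => i.
  by rewrite -invfM -expr2 sqr_sqrtr // ltW // (eigval_gt0 _ pQ').
have LQ' : L' *m Q' *m L' = 1%:M.
  by rewrite -[Q'](psd_sqrt (pd_psd pQ')) -/K' mulmxA LK' mul1mx KL'.
have LP' : L' *m P' *m L' = Z'.
  rewrite (fcalc_comm _ (pd_adj pQ') QP') -mulmxA LL'.
  by rewrite -(mpinv_comm (pd_adj pQ') QP').
have KZ : K *m Z *m K = P.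
  have KQ : Q *m mpinv Q = mpinv Q *m Q.
    by rewrite -(mpinv_comm (pd_adj pQ) (erefl (Q *m Q))).
  have QZ : Q *m Z = Z *m Q by rewrite /Z mulmxA KQ -!mulmxA QP.
  rewrite (fcalc_comm _ (pd_adj pQ) QZ) -mulmxA KK -QZ /Z mulmxA (mul_mpinv pQ).
  exact: mul1mx.
have hK' : adjmx K' = K' by apply: fcalc_adj.
rewrite -/K -/K'; clearbody K K' L'.
(* Conjugation by L' = Q'^(-1/2) turns the two hypotheses into the contraction bound and the bound
   on Z; conjugation by K' undoes it at the end. *)
pose S := L' *m T *m K.
have SS : loewner (S *m adjmx S) 1%:M.
  have := loewner_congr L' TQ; rewrite hL' LQ' /S !adjmxM hK hL' -KK.
  by rewrite !mulmxA.
have SZ : loewner (S *m Z *m adjmx S) Z'.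
  have := loewner_congr L' TP; rewrite hL' LP' /S !adjmxM hK hL' -KZ.
  by rewrite !mulmxA.
have := contraction_fcalc f_pos f_om (pd_quot pQ pP QP) (pd_quot pQ' pP' QP') SS SZ.
move=> /(loewner_congr K'); rewrite /S !adjmxM hK hL' hK'.
by rewrite !mulmxA KL' mul1mx -[_ *m L' *m K']mulmxA LK' mulmx1.
Qed.

(** * Supports and regularization of singular matrices *)

Definition supp n (A : 'M[C]_n) : 'M[C]_n := fcalc (fun x => (x != 0)%:R) A.

(** For Hermitian A this is A plus the projection onto its kernel. Being a function of A, it
    commutes with whatever commutes with A. *)
Definition regul n (A : 'M[C]_n) : 'M[C]_n :=
  fcalc (fun x => if x == 0 then 1 else x) A.

Lemma supp_adj n (A : 'M[C]_n) : adjmx (supp A) = supp A.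
Proof. exact: fcalc_adj. Qed.

Lemma supp_regul_comm n (A : 'M[C]_n) :
  supp A *m regul A = regul A *m supp A.
Proof.
by rewrite [LHS]fcalcM [RHS]fcalcM; apply: eq_fcalc => i; apply: mulrC.
Qed.

Lemma supp_idem n (A : 'M[C]_n) : supp A *m supp A = supp A.
Proof.
by rewrite fcalcM; apply: eq_fcalc => i; case: eqP; rewrite /= ?mulr0 ?mulr1.
Qed.

Lemma supp_mul n (A : 'M[C]_n) : adjmx A = A -> supp A *m A = A.
Proof.
move=> hA; rewrite fcalc_mul //; apply: eq_fcalc_id => // i.
by case: eqP => [->|]; rewrite /= ?mulr0 ?mul1r.
Qed.

Lemma supp_regul n (A : 'M[C]_n) : adjmx A = A -> supp A *m regul A = A.
Proof.
move=> hA; rewrite fcalcM; apply: eq_fcalc_id => // i.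
by case: eqP => [->|]; rewrite /= ?mul0r ?mul1r.
Qed.

Lemma pd_regul n (A : 'M[C]_n) : psdmx A -> pdmx (regul A).
Proof.
move=> pA; apply: pd_fcalc => i; case: eqVneq => // x0.
by rewrite lt_def x0 eigval_ge0.
Qed.

Lemma regul_ge n (A : 'M[C]_n) : psdmx A -> loewner A (regul A).
Proof.
move=> pA; have := fcalcB (fun x => if x == 0 then 1 else x) id A.
rewrite (fcalc_id (psd_adj pA)) /loewner => ->; apply: psd_fcalc => i.
by case: eqVneq => [->|_]; rewrite ?subr0 ?subrr.
Qed.

Lemma supp_mpinv_regul n (A : 'M[C]_n) : psdmx A ->
  supp A *m mpinv (regul A) = mpinv A.
Proof.
move=> pA; have hA := psd_adj pA.
have SV : mpinv A *m regul A = supp A.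
  rewrite mpinvE // fcalcM; apply: eq_fcalc => i.
  by case: eqVneq => [->|x0]; rewrite ?invr0 ?mul0r ?mulVf.
by rewrite -SV -mulmxA (mul_mpinv (pd_regul pA)) mulmx1.
Qed.

(** Compression by 1 - [supp Q'] annihilates Q', so (1 - [supp Q']) T carries the positive definite
    Q to something at most 0 and must vanish. *)
Lemma supp_absorb p q (T : 'M[C]_(q, p)) (Q : 'M[C]_p) (Q' : 'M[C]_q) :
  pdmx Q -> psdmx Q' -> loewner (T *m Q *m adjmx T) Q' -> supp Q' *m T = T.
Proof.
move=> pQ pQ' /(loewner_congr (1%:M - supp Q')).
have -> : (1%:M - supp Q') *m Q' = 0.
  by rewrite mulmxBl mul1mx (supp_mul (psd_adj pQ')) subrr.
rewrite mul0mx => H; apply/esym/eqP; rewrite -subr_eq0.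
have -> : T - supp Q' *m T = (1%:M - supp Q') *m T by rewrite mulmxBl mul1mx.
apply/eqP/(loewner_congr0 pQ).
by move: H; rewrite adjmxM !mulmxA.
Qed.

Local Opaque supp regul.

(** E Z agrees with Z on the range of E and is 0 on the complement, where the value 0 of [fext f] at
    0 matters. Both facts are intertwining relations, through E with Z and through 1 - E with the
    zero matrix. *)
Lemma fcalc_fext_compress n (E Z : 'M[C]_n) :
  pdmx Z -> adjmx E = E -> E *m E = E -> E *m Z = Z *m E ->
  fcalc f Z *m E = fcalc (fext f) (E *m Z).
Proof.
move=> pZ hE EE EZ; have hZ := pd_adj pZ.
have hEZ : adjmx (E *m Z) = E *m Z by rewrite adjmxM hE hZ EZ.
have WE : Z *m E = E *m (E *m Z) by rewrite mulmxA EE EZ.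
rewrite -fcalc_fext // (fcalc_intertwine (fext f) hZ hEZ WE).
have h0 : adjmx (0 : 'M[C]_n) = 0 by apply: adjmx0.
have W0 : (0 : 'M[C]_n) *m (1%:M - E) = (1%:M - E) *m (E *m Z).
  by rewrite mul0mx mulmxBl mul1mx mulmxA EE subrr.
have := fcalc_intertwine (fext f) h0 hEZ W0.
have -> : fcalc (fext f) (0 : 'M[C]_n) = 0.
  have e0 i : eigval (0 : 'M[C]_n) i = 0.
    by apply: (@complexI R); rewrite -form_eigval // mulmx0 mul0mx mxE.
  rewrite (@eq_fcalc _ (fun=> 0)); last by move=> i; rewrite e0 /fext ltxx.
  by rewrite fcalc_const (rmorph0 (real_complex R)) -scalemx1 scale0r.
rewrite mul0mx mulmxBl mul1mx => /esym/eqP; rewrite subr_eq0 => /eqP GE.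
exact/esym.
Qed.

(* Regularizing Q' and P' off their supports only enlarges them; compressing
   the resulting inequality to the joint support gives it back for Q', P'. *)
Lemma opmean_transformer p q (T : 'M[C]_(q, p)) (Q P : 'M[C]_p)
    (Q' P' : 'M[C]_q) :
  pdmx Q -> pdmx P -> Q *m P = P *m Q ->
  psdmx Q' -> psdmx P' -> Q' *m P' = P' *m Q' ->
  loewner (T *m Q *m adjmx T) Q' -> loewner (T *m P *m adjmx T) P' ->
  loewner (T *m opmean Q P *m adjmx T) (opmean Q' P').
Proof.
move=> pQ pP QP pQ' pP' QP' TQ TP.
have hQ' := psd_adj pQ'; have hP' := psd_adj pP'.
have pQ2 := pd_regul pQ'; have pP2 := pd_regul pP'.
have TQ2 := loewner_trans TQ (regul_ge pQ').
have TP2 := loewner_trans TP (regul_ge pP').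
have sQsP : supp Q' *m supp P' = supp P' *m supp Q' :=
  fcalc_comm2 _ _ hQ' hP' QP'.
have rQsP : regul Q' *m supp P' = supp P' *m regul Q' :=
  fcalc_comm2 _ _ hQ' hP' QP'.
have sQrP : supp Q' *m regul P' = regul P' *m supp Q' :=
  fcalc_comm2 _ _ hQ' hP' QP'.
have rQrP : regul Q' *m regul P' = regul P' *m regul Q' :=
  fcalc_comm2 _ _ hQ' hP' QP'.
have Q'sP : Q' *m supp P' = supp P' *m Q' := esym (fcalc_comm _ hP' (esym QP')).
have sQT := supp_absorb pQ pQ' TQ; have sPT := supp_absorb pP pP' TP.
have sQV := supp_mpinv_regul pQ'.
have sQrQ := supp_regul hQ'; have sPrP := supp_regul hP'.
have sQrQc := supp_regul_comm Q'; have sPrPc := supp_regul_comm P'.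
have hsQ := supp_adj Q'; have hsP := supp_adj P'.
have sQQ := supp_idem Q'; have sPP := supp_idem P'.
move: (supp Q') (supp P') (regul Q') (regul P') => sQ sP rQ rP in
  pQ2 pP2 TQ2 TP2 sQsP rQsP sQrP rQrP Q'sP sQT sPT sQV sQrQ sPrP sQrQc sPrPc
  hsQ hsP sQQ sPP *.
have main := opmean_transformer_pd pQ pP QP pQ2 pP2 rQrP TQ2 TP2.
(* The projection onto the joint support of Q' and P'; it fixes T and commutes with both
   regularizations. *)
pose E := sQ *m sP.
have hE : adjmx E = E by rewrite adjmxM hsQ hsP -sQsP.
have EE : E *m E = E.
  by rewrite /E mulmxA -[sQ *m sP *m sQ]mulmxA -sQsP mulmxA sQQ -mulmxA sPP.
have ET : E *m T = T by rewrite -mulmxA sPT sQT.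
have E_Q : E *m rQ = rQ *m E by rewrite /E -mulmxA -rQsP !mulmxA sQrQc.
have E_P : E *m rP = rP *m E by rewrite /E mulmxA -sQrP -!mulmxA sPrPc.
have EiQ := mpinv_comm (pd_adj pQ2) (esym E_Q).
have sPiQ := mpinv_comm (pd_adj pQ2) rQsP.
have pZ := pd_quot pQ2 pP2 rQrP.
move: main; rewrite [opmean rQ rP]/opmean (fcalc_fext pZ) => main.
have EZ : E *m (mpinv rQ *m rP) = mpinv rQ *m rP *m E.
  by rewrite mulmxA -EiQ -[_ *m E *m rP]mulmxA E_P mulmxA.
have EZE : E *m (mpinv rQ *m rP) = mpinv Q' *m P'.
  by rewrite -sQV -{1}sPrP /E -!mulmxA [sP *m (_ *m _)]mulmxA -sPiQ !mulmxA.
have GE := fcalc_fext_compress pZ hE EE EZ; rewrite EZE in GE.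
have EfZ := fcalc_comm f (pd_adj pZ) (esym EZ).
(* This absorbs the extra factor [sP] in E rQ = Q' sP when the right side is compressed. *)
have sPG : sP *m fcalc (fext f) (mpinv Q' *m P') = fcalc (fext f) (mpinv Q' *m P').
  by rewrite -GE EfZ mulmxA /E sQsP mulmxA sPP.
have ErQ : E *m rQ = Q' *m sP by rewrite /E sQsP -mulmxA sQrQ Q'sP.
have ET' : adjmx T *m E = adjmx T by rewrite -{1}hE -adjmxM ET.
have := loewner_congr E main; rewrite hE [opmean Q' P']/opmean.
move: GE sPG {EfZ main}; move: (opmean Q P).
move: (fcalc f (mpinv rQ *m rP)) (fcalc (fext f) (mpinv Q' *m P')).
move=> fZ G J0 GE sPG.
rewrite (mulmxA E rQ) ErQ -[_ *m fZ *m E]mulmxA GE -[Q' *m _ *m G]mulmxA sPG.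
by rewrite -!mulmxA ET' !mulmxA ET.
Qed.

(** Let V = J^-1, W = J'^+ and M = T^* W T. Conjugating the hypothesis by T^* W gives M - M J M >=
    0, because W J' W = W. Adding the square (M - V) J (M - V) = M J M - 2 M + V >= 0 leaves V - M
    >= 0. *)
Lemma loewner_mpinv p q (T : 'M[C]_(q, p)) (J : 'M[C]_p) (J' : 'M[C]_q) :
  pdmx J -> loewner (T *m J *m adjmx T) J' ->
  loewner (adjmx T *m mpinv J' *m T) (invmx J).
Proof.
move=> pJ TJ.
have hJ := pd_adj pJ.
have hJ' := psd_adj (loewner_psd (psd_congr T (pd_psd pJ)) TJ).
have JV := mul_mpinv pJ; have VJ := mulmx1C JV.
have hV := mpinv_adj hJ; have hW := mpinv_adj hJ'.
have [_ WJW _ _] := mpinvP hJ'.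
have -> : invmx J = mpinv J.
  by rewrite -[RHS](mulKmx (mulmx1_unit JV).1) JV mulmx1.
move: TJ => /(psd_congr (adjmx T *m mpinv J')).
have := psd_congr (adjmx T *m mpinv J' *m T - mpinv J) (pd_psd pJ).
rewrite adjmxB !adjmxM adjmxK hW hV => h1 /(psdD h1).
rewrite /loewner; congr psdmx.
move: (mpinv J) (mpinv J') JV VJ WJW {h1 hV hW} => V W JV VJ WJW.
have E1 : adjmx T *m W *m J' *m W = adjmx T *m W.
  by rewrite -!mulmxA (mulmxA W) WJW.
rewrite [(_ - V) *m J]mulmxBl VJ mulmxBl mul1mx mulmxBr (mulmxK1 _ JV).
rewrite mulmxBr mulmxBl !mulmxA E1.
move: (adjmx T *m W *m T) (adjmx T *m W *m T *m J *m adjmx T *m W *m T).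
by move=> M N; apply/matrixP=> i j; rewrite !mxE; ring.
Qed.

End OperatorMean.

(** * Schwarz maps and multiplication operators *)

(** The isometry [mxvec] turns forms of operators on matrix space into traces. *)
Lemma mxvec_form m n (A B : 'M[C]_(m, n)) :
  (mxvec A *m adjmx (mxvec B)) 0 0 = \tr (A *m adjmx B).
Proof.
rewrite mxE (reindex _ (curry_mxvec_bij m n)) /= /mxtrace.
under [RHS]eq_bigr do rewrite mxE.
rewrite pair_bigA /=; apply: eq_bigr => -[i j] _ /=.
by rewrite !mxE !mxvecE.
Qed.

Lemma tr_adj n (A : 'M[C]_n) : \tr (adjmx A) = Num.conj (\tr A).
Proof. by rewrite /mxtrace rmorph_sum; apply: eq_bigr => i _; rewrite !mxE. Qed.

Lemma tr_gram_ge0 m n (A : 'M[C]_(m, n)) : 0 <= \tr (A *m adjmx A).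
Proof.
rewrite -mxvec_form; have := proj2 (psd1 (m * n)) (mxvec A).
by rewrite mulmx1.
Qed.

Lemma tr_gram_eq0 m n (A : 'M[C]_(m, n)) : \tr (A *m adjmx A) = 0 -> A = 0.
Proof.
rewrite -mxvec_form => /form_gram_eq0/eqP.
by rewrite mxvec_eq0 => /eqP.
Qed.

Lemma tr_psd_gram m n (Y : 'M[C]_m) (A : 'M[C]_(m, n)) : psdmx Y ->
  \tr (Y *m (A *m adjmx A)) =
  \tr ((fcalc Num.sqrt Y *m A) *m adjmx (fcalc Num.sqrt Y *m A)).
Proof.
move=> /psd_sqrt; have := fcalc_adj Num.sqrt Y.
move: (fcalc _ Y) => K hK <-.
by rewrite adjmxM hK !mulmxA [RHS]mxtrace_mulC !mulmxA.
Qed.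

Lemma tr_psd_mul n (Y G : 'M[C]_n) : psdmx Y -> psdmx G -> 0 <= \tr (Y *m G).
Proof.
move=> pY pG; rewrite -(psd_sqrt pG) -{2}(fcalc_adj _ G) tr_psd_gram //.
exact: tr_gram_ge0.
Qed.

Lemma tr_pd_gram m n (Y : 'M[C]_m) (A : 'M[C]_(m, n)) : pdmx Y -> A != 0 ->
  0 < \tr (Y *m (A *m adjmx A)).
Proof.
move=> pY A0; rewrite (tr_psd_gram _ (pd_psd pY)) lt_def tr_gram_ge0 andbT.
apply: contra A0 => /eqP/tr_gram_eq0 KA.
have LK := mulmx1C (sqrt_mulV pY).
move: (fcalc Num.sqrt Y) (fcalc _ Y) KA LK => K L KA LK.
by rewrite -[A]mul1mx -LK -mulmxA KA mulmx0.
Qed.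

(** Each entry of [opmat u] is the trace pairing of the image of one matrix unit with another, so
    the adjoint relation can be read entrywise. *)
Lemma opmat_adj m n (g : 'M[C]_m -> 'M[C]_n) (h : 'M[C]_n -> 'M[C]_m) :
  (forall A B, \tr (g A *m adjmx B) = \tr (A *m adjmx (h B))) ->
  adjmx (opmat h) = opmat g.
Proof.
have form k l (u : 'M[C]_k -> 'M[C]_l) i j : opmat u i j =
    \tr (u (vec_mx (delta_mx 0 i)) *m adjmx (vec_mx (delta_mx 0 j))).
  rewrite -mxvec_form vec_mxK !mxE (bigD1 j) //= big1 ?addr0 => [|k' kj].
    by rewrite !mxE !eqxx rmorph1 mulr1.
  by rewrite !mxE eqxx (negPf kj) rmorph0 mulr0.
move=> gh; apply/matrixP => i j; rewrite [LHS]mxE [X in Num.conj X]mxE !form.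
by rewrite gh -tr_adj adjmxM adjmxK.
Qed.

Lemma opmat_pd n (g : {linear 'M[C]_n -> 'M[C]_n}) :
  adjmx (opmat g) = opmat g ->
  (forall A, A != 0 -> 0 < \tr (g A *m adjmx A)) -> pdmx (opmat g).
Proof.
move=> hg pg; split=> // v v0; have := pg (vec_mx v).
rewrite -mxvec_form vec_mxK -mul_rV_lin; apply.
by apply: contra v0; rewrite -mxvec_eq0 vec_mxK.
Qed.

Lemma RopE n (X : 'M[C]_n) : Rop X = opmat (mulmxr X).
Proof. by []. Qed.

Lemma Lop_adj n (Y : 'M[C]_n) : adjmx Y = Y -> adjmx (Lop Y) = Lop Y.
Proof.
move=> hY; apply: opmat_adj => A B.
by rewrite adjmxM hY mulmxA [RHS]mxtrace_mulC mulmxA.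
Qed.

Lemma Rop_adj n (X : 'M[C]_n) : adjmx X = X -> adjmx (Rop X) = Rop X.
Proof. by move=> hX; apply: opmat_adj => A B; rewrite adjmxM hX mulmxA. Qed.

Lemma Lop_pd n (Y : 'M[C]_n) : pdmx Y -> pdmx (Lop Y).
Proof.
move=> pY; apply: opmat_pd => [|A A0]; first exact/Lop_adj/pd_adj.
by rewrite -mulmxA; apply: tr_pd_gram.
Qed.

Lemma Rop_pd n (X : 'M[C]_n) : pdmx X -> pdmx (Rop X).
Proof.
move=> pX; rewrite RopE; apply: opmat_pd => [|A A0]; first exact/Rop_adj/pd_adj.
rewrite /= -mulmxA mxtrace_mulC -mulmxA -{2}[A]adjmxK; apply: tr_pd_gram => //.
by apply: contra A0 => /eqP A0; rewrite -[A]adjmxK A0 adjmx0.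
Qed.

Lemma Lop_Rop_comm n (X Y : 'M[C]_n) : Lop Y *m Rop X = Rop X *m Lop Y.
Proof.
apply/row_matrixP => i; rewrite !rowE !mulmxA -[delta_mx 0 i]vec_mxK RopE.
by rewrite /Lop /opmat !mul_vec_lin /= mulmxA.
Qed.

Section SchwarzMap.
Variables (n m : nat) (phi : {linear 'M[C]_n -> 'M[C]_m}).
Variable phis : 'M[C]_m -> 'M[C]_n.
Hypothesis phis_adj : forall (B : 'M[C]_m) (A : 'M[C]_n),
  hs (phis B) A = hs B (phi A).
Hypothesis schwarz : forall K : 'M[C]_n,
  loewner (adjmx (phi K) *m phi K) (phi (adjmx K *m K)).

(** The image dominates a Gram matrix, hence is positive semidefinite and in particular
    Hermitian. *)
Lemma schwarz_gram_adj (K : 'M[C]_n) :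
  adjmx (phi (adjmx K *m K)) = phi (adjmx K *m K).
Proof.
apply/psd_adj/(loewner_psd _ (schwarz K)).
by have := psd_gram (adjmx (phi K)); rewrite adjmxK.
Qed.

(* Polarization on (1 + A)^* (1 + A) with A and 'i A. *)
Lemma schwarz_adj (A : 'M[C]_n) : phi (adjmx A) = adjmx (phi A).
Proof.
have H B : adjmx (phi B) + adjmx (phi (adjmx B)) = phi B + phi (adjmx B).
  have := schwarz_gram_adj (1%:M + B).
  rewrite adjmxD adjmx1 mulmxDl !mulmxDr mul1mx mulmx1 mul1mx.
  have := schwarz_gram_adj 1%:M; rewrite adjmx1 mulmx1 => h1.
  rewrite !linearD /= !adjmxD schwarz_gram_adj h1 -!addrA => /addrI.
  by rewrite !addrA => /addIr.
(* At 'i A the identity for sums becomes one for differences; half the sum of the two isolates a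
   single term. *)
have := H ('i *: A); rewrite adjmxZ !linearZ /= !adjmxZ conjCK conjCi.
rewrite !scaleNr -!scalerBr => h.
have h2 : 'i *: (adjmx (phi (adjmx A)) - adjmx (phi A)) =
    'i *: (phi A - phi (adjmx A)) by rewrite scalerBr addrC.
move: h2 (H A) => /(scalerI (neq0Ci _)); clear=> h2 h1.
have half (a b : 'M[C]_m) : a = 2^-1 *: ((b + a) + (a - b)).
  by apply/matrixP => i j; rewrite !mxE; field.
apply: (can_inj (@adjmxK _ _)); rewrite adjmxK.
rewrite (half (adjmx (phi _)) (adjmx (phi A))) h1 h2 [RHS](half _ (phi (adjmx A))).
by rewrite [phi A + _]addrC.
Qed.

Lemma phis_trE A B : \tr (phi A *m adjmx B) = \tr (A *m adjmx (phis B)).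
Proof.
by rewrite mxtrace_mulC [RHS]mxtrace_mulC; have := phis_adj B A; rewrite /hs.
Qed.

Lemma phis_herm (Y : 'M[C]_m) : adjmx Y = Y -> adjmx (phis Y) = phis Y.
Proof.
move=> hY; pose D := adjmx (phis Y) - phis Y.
(* D is trace-orthogonal to every A because phi commutes with adjoints; testing against D^* then
   gives D = 0. *)
have trD A : \tr (A *m D) = 0.
  rewrite mulmxBr linearB /= -phis_trE hY; apply/eqP; rewrite subr_eq0; apply/eqP.
  rewrite -[RHS]conjCK -tr_adj adjmxM [X in _ = Num.conj X]mxtrace_mulC.
  by rewrite -phis_trE schwarz_adj hY -tr_adj adjmxM adjmxK hY mxtrace_mulC.
have := trD (adjmx D); rewrite -{2}[D]adjmxK => /tr_gram_eq0 D0.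
by apply/eqP; rewrite -subr_eq0 -/D -[D]adjmxK D0 adjmx0.
Qed.

Lemma opmat_phis_adj : opmat phis = adjmx (opmat phi).
Proof. by rewrite -[LHS]adjmxK (opmat_adj phis_trE). Qed.

(** The Schwarz inequality at K = A^*, paired with Y, gives tr(Y phi(A) phi(A)^* ) <= tr(Y phi(A A^*
    )) = tr(phis(Y) A A^* ). *)
Lemma schwarz_Lop (Y : 'M[C]_m) : pdmx Y ->
  loewner (opmat phi *m Lop Y *m adjmx (opmat phi)) (Lop (phis Y)).
Proof.
move=> pY; have hY := pd_adj pY; have hL := Lop_adj (phis_herm hY).
split=> [|v].
  by rewrite adjmxB !adjmxM adjmxK hL (Lop_adj hY) mulmxA.
rewrite mulmxBr mulmxBl mxE [X in _ + X]mxE subr_ge0.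
rewrite -[v]vec_mxK; set A := vec_mx v.
rewrite !mulmxA /Lop /opmat !mul_vec_lin -mulmxA -adjmxM mul_vec_lin !mxvec_form.
have := schwarz (adjmx A); rewrite schwarz_adj !adjmxK => H.
have := tr_psd_mul (pd_psd pY) H.
rewrite mulmxBr linearB /= subr_ge0 mulmxA => /le_trans; apply.
rewrite -{1}hY mxtrace_mulC phis_trE (phis_herm hY) mxtrace_mulC mulmxA.
exact: lexx.
Qed.

(** Right multiplication puts the adjoint on the left factor, tr(X phi(A)^* phi(A)), so the Schwarz
    inequality applies at K = A itself. *)
Lemma schwarz_Rop (X : 'M[C]_m) : pdmx X ->
  loewner (opmat phi *m Rop X *m adjmx (opmat phi)) (Rop (phis X)).
Proof.
move=> pX; have hX := pd_adj pX; have hR := Rop_adj (phis_herm hX).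
split=> [|v].
  by rewrite adjmxB !adjmxM adjmxK hR (Rop_adj hX) mulmxA.
rewrite mulmxBr mulmxBl mxE [X in _ + X]mxE subr_ge0.
rewrite -[v]vec_mxK; set A := vec_mx v.
rewrite !mulmxA !RopE /opmat !mul_vec_lin -mulmxA -adjmxM mul_vec_lin.
rewrite !mxvec_form /=.
have := tr_psd_mul (pd_psd pX) (schwarz A).
rewrite mulmxBr linearB /= subr_ge0 mulmxA mxtrace_mulC mulmxA => /le_trans; apply.
rewrite -{1}hX mxtrace_mulC phis_trE (phis_herm hX).
rewrite -mulmxA mxtrace_mulC.
exact: lexx.
Qed.

End SchwarzMap.

End MatrixOrder.

Theorem theorem4p4 (R : realType) (f : R -> R)
  (f_pos : forall x : R, 0 < x -> 0 < f x)
  (f_om : operator_monotone f)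
  (n m : nat) (phi : {linear 'M[R[i]]_n -> 'M[R[i]]_m})
  (phis : 'M[R[i]]_m -> 'M[R[i]]_n)
  (phis_adj : forall (B : 'M[R[i]]_m) (A : 'M[R[i]]_n),
      hs (phis B) A = hs B (phi A))
  (schwarz : forall K : 'M[R[i]]_n,
      loewner (adjmx (phi K) *m phi K) (phi (adjmx K *m K)))
  (X Y : 'M[R[i]]_m) (hX : pdmx X) (hY : pdmx Y) :
  loewner (opmat phis *m mpinv (Jf f (phis X) (phis Y)) *m opmat phi)
          (invmx (Jf f X Y))
  /\
  loewner (opmat phi *m Jf f X Y *m opmat phis)
          (Jf f (phis X) (phis Y)).
Proof.
have pL := Lop_pd hY; have pR := Rop_pd hX.
have TL := schwarz_Lop phis_adj schwarz hY.
have TR := schwarz_Rop phis_adj schwarz hX.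
(* The operators on the image side dominate positive semidefinite ones; they may be singular. *)
have pL' := loewner_psd (psd_congr (opmat phi) (pd_psd pL)) TL.
have pR' := loewner_psd (psd_congr (opmat phi) (pd_psd pR)) TR.
have B := opmean_transformer f_pos f_om pL pR (Lop_Rop_comm X Y) pL' pR'
  (Lop_Rop_comm _ _) TL TR.
rewrite (opmat_phis_adj phis_adj); split; last exact: B.
exact: loewner_mpinv (pd_opmean f_pos pL pR (Lop_Rop_comm X Y)) B.
Qed.
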